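(* Let $n\ge 0$ and let $d\mu$ be a probability measure on the unit circle $S^1\subset\mathbb{C}$ such that either (i) the support of $d\mu$ is finite and consists of $N\ge n+2$ points, or (ii) the Verblunsky coefficients of $d\mu$ are periodic with even period $p\ge n+1$. Let $\{\cdot,\cdot\}$ denote the Poisson bracket in the Verblunsky coefficients corresponding to case (i) or (ii), as appropriate. Then the Poisson brackets of the Wall polynomials $A_n,B_n$ and their reversed polynomials $A_n^*,B_n^*$, regarded as functions of the Verblunsky coefficients, are given for all $z\neq w$ in $\mathbb{C}$ by $$\{A_n(z),A_n(w)\}=\{B_n(z),B_n(w)\}=0,$$ $$\{A_n(z),A_n^*(w)\}=iA_n(z)A_n^*(w)-\frac{i}{z-w}\bigl(zB_n^*(z)B_n(w)-wB_n^*(w)B_n(z)\bigr),$$ $$\{B_n(z),B_n^*(w)\}=\frac{iz}{z-w}\bigl(A_n(z)A_n^*(w)-A_n(w)A_n^*(z)\bigr),$$ $$\{A_n(z),B_n(w)\}=\frac{-iw}{z-w}\bigl(A_n(z)B_n(w)-A_n(w)B_n(z)\bigr),$$ $$\{A_n(z),B_n^*(w)\}=\frac{iz}{z-w}\bigl(A_n(z)B_n^*(w)-A_n(w)B_n^*(z)\bigr).$$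
   Context: Let $\mathbb{D}=\{z\in\mathbb{C}: |z|<1\}$. A probability measure $d\mu$ on $S^1$ has Verblunsky coefficients $\alpha_k$, defined by the recurrence for its monic orthogonal polynomials: $\Phi_0=\Phi_0^*=1$, $\Phi_{k+1}(z)=z\Phi_k(z)-\bar\alpha_k\Phi_k^*(z)$, $\Phi_{k+1}^*(z)=\Phi_k^*(z)-\alpha_k z\Phi_k(z)$, where $\Phi_k^*(z)=z^k\,\overline{\Phi_k(1/\bar z)}$. If $d\mu$ is supported at exactly $N$ points, then $\alpha_0,\dots,\alpha_{N-2}\in\mathbb{D}$ and $\alpha_{N-1}\in S^1$; if the support is infinite, all $\alpha_k\in\mathbb{D}$. In both cases measures and coefficient sequences are in 1-1 correspondence. The Wall polynomials $A_n,B_n$ (polynomials in $z$ of degree at most $n$, depending on $\alpha_0,\dots,\alpha_n$) and their reversed polynomials $A_n^*(z)=z^n\,\overline{A_n(1/\bar z)}$, $B_n^*(z)=z^n\,\overline{B_n(1/\bar z)}$ are defined by the transfer matrix identity $$\begin{bmatrix} z & -\bar\alpha_n\\ -\alpha_n z & 1\end{bmatrix}\begin{bmatrix} z & -\bar\alpha_{n-1}\\ -\alpha_{n-1} z & 1\end{bmatrix}\cdots\begin{bmatrix} z & -\bar\alpha_0\\ -\alpha_0 z & 1\end{bmatrix}=\begin{bmatrix} zB_n^*(z) & -A_n^*(z)\\ -zA_n(z) & B_n(z)\end{bmatrix}.$$ They are regarded as functions of the Verblunsky coefficients, with $z\in\mathbb{C}$ a parameter. Put $\rho_k=\sqrt{1-|\alpha_k|^2}$,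 and for $\alpha=u+iv$ use $\partial/\partial\alpha=\frac12(\partial_u-i\partial_v)$, $\partial/\partial\bar\alpha=\frac12(\partial_u+i\partial_v)$. Poisson brackets: in the finite case ($N$ support points), for smooth functions $f,g$ on $\mathbb{D}^{N-1}\times S^1$, $$\{f,g\}=i\sum_{k=0}^{N-2}\rho_k^2\left[\frac{\partial f}{\partial\bar\alpha_k}\frac{\partial g}{\partial\alpha_k}-\frac{\partial f}{\partial\alpha_k}\frac{\partial g}{\partial\bar\alpha_k}\right];$$ in the periodic case with (even) period $p$, for smooth $f,g$ on $\mathbb{D}^p=\{(\alpha_0,\dots,\alpha_{p-1}):\alpha_j\in\mathbb{D}\}$, the same formula with the sum running over $0\le k\le p-1$. *)

(* Defs.v *)
From HB Require Import structures.
From mathcomp Require Import all_boot all_order all_algebra.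
From mathcomp Require Import all_classical all_reals all_analysis.
From mathcomp Require Import complex.

Set Implicit Arguments.
Unset Strict Implicit.
Unset Printing Implicit Defensive.

Import Order.TTheory GRing.Theory Num.Theory numFieldNormedType.Exports.

Local Open Scope classical_set_scope.
Local Open Scope ring_scope.

Notation "'CC' R" := (complex (Real.sort R)) (at level 10, only parsing).

(* The complex plane with its Borel sigma-algebra. The cast selects the metric
   topology that every numFieldType carries. *)
Notation borelCC R := (g_sigma_algebraType (@open (CC R : numFieldType))).

(* A probability measure on S^1 is a Borel probability measure on the plane
   giving mass 1 to [unit_circle R]. *)
Definition unit_circle (R : realType) : set (CC R) := [set z | `|z| = 1].
Arguments unit_circle : clear implicits.

Definition measure_support (R : realType) (mu : probability (borelCC R) R) :
    set (CC R) :=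
  [set x | forall U : set (CC R : numFieldType),
     open U -> U x -> (0 < mu (U : set (borelCC R)))%E].

Definition circle_integral (R : realType) (mu : probability (borelCC R) R)
    (f : CC R -> CC R) : CC R :=
  Complex (\int[mu]_(x in (unit_circle R : set (borelCC R))) complex.Re (f x))
          (\int[mu]_(x in (unit_circle R : set (borelCC R))) complex.Im (f x)).

(* The polynomial z^n * conj (P (1 / conj z)); see [horner_revp]. *)
Definition revp (R : realType) (n : nat) (P : {poly CC R}) : {poly CC R} :=
  \poly_(i < n.+1) (P`_(n - i))^*.

Definition is_monic_op (R : realType) (mu : probability (borelCC R) R)
    (k : nat) (P : {poly CC R}) : Prop :=
  [/\ P \is monic, size P = k.+1 &
      forall j, (j < k)%N ->
        circle_integral mu (fun z => (z ^+ j)^* * P.[z]) = 0].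

(* a 0, ..., a m.-1 are the first m Verblunsky coefficients of mu. For a measure
   with exactly m support points this includes the last, unimodular one: the
   monic polynomial of degree m is then the one vanishing on the support. *)
Definition verblunsky (R : realType) (mu : probability (borelCC R) R)
    (m : nat) (a : nat -> CC R) : Prop :=
  exists Phi : nat -> {poly CC R},
    (forall k, (k <= m)%N -> is_monic_op mu k (Phi k)) /\
    (forall k, (k < m)%N ->
       Phi k.+1 = 'X * Phi k - (a k)^* *: revp k (Phi k)).

Section Wall.
Variable R : realType.
Implicit Types (a : nat -> CC R) (n : nat).

Definition transfer_step (c : CC R) : 'M[{poly CC R}]_2 :=
  \matrix_(i, j)
    if i == 0 then (if j == 0 then 'X else - (c^*)%:P)
    else (if j == 0 then - (c *: 'X) else 1).

Fixpoint transfer n a : 'M[{poly CC R}]_2 :=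
  if n is n'.+1 then transfer_step (a n) *m transfer n' a
  else transfer_step (a 0%N).

(* Read off from the second row of the transfer matrix; the full transfer
   matrix identity is [transfer_wall]. *)
Definition wallA n a : {poly CC R} := (- transfer n a 1 0) %/ 'X.
Definition wallB n a : {poly CC R} := transfer n a 1 1.
Definition wallAs n a : {poly CC R} := revp n (wallA n a).
Definition wallBs n a : {poly CC R} := revp n (wallB n a).

Lemma horner_revp n (P : {poly CC R}) (z : CC R) :
  (size P <= n.+1)%N -> z != 0 ->
  (revp n P).[z] = z ^+ n * (P.[(z^*)^-1])^*.
Proof.
move=> sP z0; rewrite horner_poly (horner_coef_wide _ sP) rmorph_sum /=.
rewrite mulr_sumr (reindex_inj rev_ord_inj) /=; apply: eq_bigr => i _.
have iLn : (i <= n)%N by rewrite -ltnS.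
rewrite subSS subKn// rmorphM /= mulrCA rmorphXn /= fmorphV /= conjCK.
congr (_ * _); apply: (mulIf (expf_neq0 i z0)).
by rewrite -exprD subnK// exprVn mulfVK// expf_neq0.
Qed.

Lemma revpD n (P Q : {poly CC R}) : revp n (P + Q) = revp n P + revp n Q.
Proof.
apply/polyP => i; rewrite coefD !coef_poly.
by case: ifP; rewrite ?addr0// coefD rmorphD.
Qed.

Lemma revpZ n (c : CC R) (P : {poly CC R}) :
  revp n (c *: P) = c^* *: revp n P.
Proof.
apply/polyP => i; rewrite coefZ !coef_poly.
by case: ifP; rewrite ?mulr0// coefZ rmorphM.
Qed.

Lemma revpS n (P : {poly CC R}) :
  (size P <= n.+1)%N -> revp n.+1 P = 'X * revp n P.
Proof.
move=> sP; apply/polyP => -[|i]; rewrite coefXM /= !coef_poly /=.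
  by rewrite nth_default ?rmorph0.
by rewrite ltnS subSS.
Qed.

Lemma revpXrev n (P : {poly CC R}) :
  (size P <= n.+1)%N -> revp n.+1 ('X * revp n P) = P.
Proof.
move=> sP; apply/polyP => i; rewrite coef_poly.
have [iS|nS] := ltnP i n.+2; last first.
  by rewrite nth_default// (leq_trans sP)// (leq_trans _ nS).
rewrite coefXM subn_eq0; have [ni|iLn] := ltnP n i.
  by rewrite rmorph0 nth_default// (leq_trans sP).
by rewrite subSn//= coef_poly ltnS leq_subr conjCK subKn.
Qed.

Lemma size_revp n (P : {poly CC R}) : (size (revp n P) <= n.+1)%N.
Proof. exact: size_poly. Qed.

Let transfer_aux n a : exists A B : {poly CC R},
  [/\ (size A <= n.+1)%N, (size B <= n.+1)%N &
   [/\ transfer n a 0 0 = 'X * revp n B, transfer n a 0 1 = - revp n A,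
       transfer n a 1 0 = - ('X * A) & transfer n a 1 1 = B]].
Proof.
elim: n => [|n [A [B [sA sB [T00 T01 T10 T11]]]]].
  exists (a 0%N)%:P, 1; rewrite size_polyC_leq1 size_poly1; split=> //.
  split; rewrite mxE //=; last by rewrite mulrC mul_polyC.
    rewrite /revp -[LHS]mulr1; congr (_ * _); apply/polyP => -[|i].
      by rewrite coef_poly !coef1 /= conjC1.
    by rewrite coef_poly !coef1.
  rewrite /revp; congr (- _); apply/polyP => -[|i].
    by rewrite coef_poly !coefC.
  by rewrite coef_poly coefC.
exists (A + a n.+1 *: ('X * revp n B)), (B + a n.+1 *: ('X * revp n A)).
have sX (P : {poly CC R}) : (size ('X * revp n P)%R <= n.+2)%N.
  by rewrite (leq_trans (size_polyMleq _ _))// size_polyX ltnS size_revp.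
split.
- rewrite (leq_trans (size_polyD _ _))// geq_max (leq_trans sA)//.
  by rewrite (leq_trans (size_scale_leq _ _)).
- rewrite (leq_trans (size_polyD _ _))// geq_max (leq_trans sB)//.
  by rewrite (leq_trans (size_scale_leq _ _)).
rewrite !revpD !revpZ !revpXrev// !revpS//.
have E0 : lift ord0 ord0 = 1 :> 'I_2 by apply/val_inj.
split; rewrite /= mxE !big_ord_recl big_ord0 E0 !mxE /= addr0.
- by rewrite T00 T10 mulrNN -mul_polyC mulrDr; congr (_ + _); exact: mulrCA.
- by rewrite T01 T11 mulrN opprD mulNr -mul_polyC.
- rewrite T00 T10 mul1r mulNr -!mul_polyC mulrDr opprD addrC -mulrA.
  by congr (_ - _); exact: mulrCA.
- by rewrite T01 T11 mul1r mulrNN -!mul_polyC -mulrA addrC.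
Qed.

Lemma transfer_wall n a :
  [/\ transfer n a 0 0 = 'X * wallBs n a, transfer n a 0 1 = - wallAs n a,
      transfer n a 1 0 = - ('X * wallA n a) & transfer n a 1 1 = wallB n a].
Proof.
have [A [B [_ _ [T00 T01 T10 T11]]]] := transfer_aux n a.
have EA : wallA n a = A.
  by rewrite /wallA T10 opprK mulrC mulpK// polyX_eq0.
by rewrite /wallAs /wallBs /wallB EA T00 T01 T10 T11.
Qed.

Lemma size_wall n a : (size (wallA n a) <= n.+1)%N /\ (size (wallB n a) <= n.+1)%N.
Proof.
have [A [B [sA sB [_ _ T10 T11]]]] := transfer_aux n a.
by rewrite /wallA /wallB T10 T11 opprK mulrC mulpK// polyX_eq0.
Qed.

End Wall.

Section Poisson.
Variables (R : realType) (m : nat).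
Implicit Types (f g : ('I_m -> CC R) -> CC R) (a : 'I_m -> CC R).

(* Derivative at t = 0 of f along t |-> a + t v e_k, t real. *)
Definition dir_deriv (k : 'I_m) (v : CC R) f a : CC R :=
  let F (t : R) := f (fun j => if j == k then a j + t%:C%C * v else a j) in
  Complex (derive1 (fun t => complex.Re (F t)) 0)
          (derive1 (fun t => complex.Im (F t)) 0).

Definition d_alpha (k : 'I_m) f a : CC R :=
  2^-1 * (dir_deriv k 1 f a - 'i * dir_deriv k 'i f a).

Definition d_alphabar (k : 'I_m) f a : CC R :=
  2^-1 * (dir_deriv k 1 f a + 'i * dir_deriv k 'i f a).

Definition rho (c : CC R) : CC R := sqrtC (1 - `|c| ^+ 2).

(* Only the first K of the m coordinates enter the bracket: K = m.-1 in the
   finite case (m support points) and K = m in the periodic case (period m). *)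
Definition poisson (K : nat) f g a : CC R :=
  'i * \sum_(k < m | (k < K)%N) rho (a k) ^+ 2 *
    (d_alphabar k f a * d_alpha k g a - d_alpha k f a * d_alphabar k g a).

(* The value outside 'I_m is immaterial: wall polynomials of index n only read
   the coefficients 0, ..., n, and they are used with n < m. *)
Definition coords a (k : nat) : CC R :=
  if insub k is Some i then a i else 0.

Definition wall_brackets (K n : nat) a : Prop :=
  let A z := fun b : 'I_m -> CC R => (wallA n (coords b)).[z] in
  let B z := fun b : 'I_m -> CC R => (wallB n (coords b)).[z] in
  let As z := fun b : 'I_m -> CC R => (wallAs n (coords b)).[z] in
  let Bs z := fun b : 'I_m -> CC R => (wallBs n (coords b)).[z] in
  forall z w : CC R, z != w ->
  [/\ poisson K (A z) (A w) a = 0 /\ poisson K (B z) (B w) a = 0,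
      poisson K (A z) (As w) a =
        'i * A z a * As w a
        - 'i / (z - w) * (z * Bs z a * B w a - w * Bs w a * B z a),
      poisson K (B z) (Bs w) a =
        'i * z / (z - w) * (A z a * As w a - A w a * As z a),
      poisson K (A z) (B w) a =
        - 'i * w / (z - w) * (A z a * B w a - A w a * B z a) &
      poisson K (A z) (Bs w) a =
        'i * z / (z - w) * (A z a * Bs w a - A w a * Bs z a)].

(* D^(m-1) x S^1 *)
Definition finite_phase a : Prop :=
  (forall k : 'I_m, (k < m.-1)%N -> `|a k| < 1) /\
  (forall k : 'I_m, nat_of_ord k = m.-1 -> `|a k| = 1).

(* D^m *)
Definition periodic_phase a : Prop := forall k : 'I_m, `|a k| < 1.

End Poisson.

(* Main.v *)
Require Import Defs.
From HB Require Import structures.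
From mathcomp Require Import all_boot all_order all_algebra.
From mathcomp Require Import all_classical all_reals all_analysis.
From mathcomp Require Import complex.
From mathcomp Require Import ring.

Set Implicit Arguments.
Unset Strict Implicit.
Unset Printing Implicit Defensive.

Import Order.TTheory GRing.Theory Num.Theory numFieldNormedType.Exports.

Local Open Scope classical_set_scope.
Local Open Scope card_scope.
Local Open Scope ring_scope.

(** At every point of coefficient space, the identities are algebraic
    consequences of the Szego recursion, because
    [rho (a k) ^+ 2 = 1 - a k * (a k)^* ] is polynomial in the coefficients and
    their conjugates. They are proved by induction on [n].

    Multiplying by one more transfer matrix gives ([wallS]), with [c] the new
    coefficient and [d] its conjugate,
      [A' = A + c z Bs], [B' = B + c z As],
      [As' = z As + d B], [Bs' = z Bs + d A].
    The bracket is bilinear, antisymmetric and a derivation. The old polynomials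
    do not involve [c], so they Poisson commute with [c] and [d]
    ([poisson_disjoint]), while [{c, d} = - i (1 - c d)]
    ([poisson_coord_conj]). Hence every new bracket is a combination of old ones
    plus a multiple of [1 - c d] ([poisson_step]).

    Expanding [{A', A'}] already produces [{A, Bs}] and [{Bs, Bs}]; closing the
    induction requires all sixteen brackets of the four polynomials at the pair
    [(z, w)]. Antisymmetry reduces these to ten formulas at [(z, w)] and
    [(w, z)], collected in [bracket_table]: those of the theorem, and four more
    ([{As, As}], [{Bs, Bs}], [{B, As}], [{As, Bs}]) that correspond to them
    under reversal, the bracket being real. The induction step
    [bracket_table_step] is then an identity of rational functions in [z], [w],
    [c], [d] and the eight values of the four polynomials at [z] and [w], all of
    them treated as independent variables. *)

(** * Derivatives of complex-valued curves at time 0 *)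

Section CurveDerivative.
Variable R : realType.
Implicit Types (F G : R -> CC R) (c d e : CC R).

(** The real and imaginary parts are differentiated separately to match
    [dir_deriv], which is built from real derivatives. *)
Definition curve_derive F d : Prop :=
  is_derive (0 : R) (1 : R) (fun t => complex.Re (F t)) (complex.Re d) /\
  is_derive (0 : R) (1 : R) (fun t => complex.Im (F t)) (complex.Im d).

Lemma curve_derive_cst c : curve_derive (fun=> c) 0.
Proof. by split; exact: is_derive_cst. Qed.

Lemma ReD (x y : CC R) : complex.Re (x + y) = complex.Re x + complex.Re y.
Proof. by case: x; case: y. Qed.

Lemma ImD (x y : CC R) : complex.Im (x + y) = complex.Im x + complex.Im y.
Proof. by case: x; case: y. Qed.

Lemma ReM (x y : CC R) :
  complex.Re (x * y) = complex.Re x * complex.Re y - complex.Im x * complex.Im y.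
Proof. by case: x; case: y. Qed.

Lemma ImM (x y : CC R) :
  complex.Im (x * y) = complex.Re x * complex.Im y + complex.Im x * complex.Re y.
Proof. by case: x; case: y. Qed.

Lemma curve_deriveD F G d e : curve_derive F d -> curve_derive G e ->
  curve_derive (fun t => F t + G t) (d + e).
Proof.
move=> [Fr Fi] [Gr Gi]; split.
- rewrite ReD /=.
  rewrite (_ : (fun t => _) =
    (fun t => complex.Re (F t)) + (fun t => complex.Re (G t))).
    exact: is_deriveD.
  by apply/funext => t; rewrite ReD.
- rewrite ImD /=.
  rewrite (_ : (fun t => _) =
    (fun t => complex.Im (F t)) + (fun t => complex.Im (G t))).
    exact: is_deriveD.
  by apply/funext => t; rewrite ImD.
Qed.

Lemma curve_deriveM F G d e : curve_derive F d -> curve_derive G e ->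
  curve_derive (fun t => F t * G t) (F 0 * e + d * G 0).
Proof.
move=> [Fr Fi] [Gr Gi]; split.
- rewrite (_ : (fun t => _) =
    (fun t => complex.Re (F t)) * (fun t => complex.Re (G t)) -
    (fun t => complex.Im (F t)) * (fun t => complex.Im (G t))); last first.
    by apply/funext => t; rewrite ReM.
  apply: (is_derive_eq (is_deriveB (is_deriveM Fr Gr) (is_deriveM Fi Gi))).
  rewrite ReD !ReM /GRing.scale /=; ring.
- rewrite (_ : (fun t => _) =
    (fun t => complex.Re (F t)) * (fun t => complex.Im (G t)) +
    (fun t => complex.Im (F t)) * (fun t => complex.Re (G t))); last first.
    by apply/funext => t; rewrite ImM.
  apply: (is_derive_eq (is_deriveD (is_deriveM Fr Gi) (is_deriveM Fi Gr))).
  rewrite ImD !ImM /GRing.scale /=; ring.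
Qed.

Lemma curve_derive_conj F d :
  curve_derive F d -> curve_derive (fun t => (F t)^*) d^*.
Proof.
have cr (x : CC R) : complex.Re x^* = complex.Re x by case: x.
have ci (x : CC R) : complex.Im x^* = - complex.Im x by case: x.
move=> [Fr Fi]; split.
- by rewrite cr (_ : (fun t => _) = fun t => complex.Re (F t)) //; apply/funext => t.
- rewrite ci (_ : (fun t => _) = - (fun t => complex.Im (F t))).
    exact: is_deriveN.
  by apply/funext => t; rewrite ci.
Qed.

Lemma curve_derive_line c d : curve_derive (fun t => c + t%:C%C * d) d.
Proof.
have dt : curve_derive (fun t => t%:C%C) 1.
  by split; [exact: is_derive_id | exact: is_derive_cst].
have := curve_deriveD (curve_derive_cst c) (curve_deriveM dt (curve_derive_cst d)).
by rewrite mulr0 mul1r !add0r.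
Qed.

Lemma curve_derive_val F d : curve_derive F d ->
  Complex (derive1 (fun t => complex.Re (F t)) 0)
          (derive1 (fun t => complex.Im (F t)) 0) = d.
Proof.
by move=> [[_ Fr] [_ Fi]]; rewrite !derive1E Fr Fi; case: d {Fr Fi}.
Qed.

End CurveDerivative.

(** * The Poisson bracket as a derivation *)

(** [ring] compares atoms up to conversion, which would unfold derivatives into
    limits; replacing them by variables avoids this. *)
Ltac ring_atoms :=
  repeat match goal with
  | |- context [poisson ?K ?f ?g ?a] => move: (poisson K f g a) => ?
  | |- context [d_alpha ?k ?f ?a] => move: (d_alpha k f a) => ?
  | |- context [d_alphabar ?k ?f ?a] => move: (d_alphabar k f a) => ?
  | |- context [dir_deriv ?k ?v ?f ?a] => move: (dir_deriv k v f a) => ?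
  end; ring.

Section PoissonRules.
Variables (R : realType) (m : nat).
Implicit Types (f g h u : ('I_m -> CC R) -> CC R) (a b : 'I_m -> CC R).
Implicit Types (k j : 'I_m) (v : CC R).

Definition perturb a k v (t : R) : 'I_m -> CC R :=
  fun j => if j == k then a j + t%:C%C * v else a j.

(** The form of smoothness under which [dir_deriv] obeys the Leibniz rule:
    differentiability along real lines inside each coordinate plane. *)
Definition smooth_at a f : Prop :=
  forall k v, exists d, curve_derive (fun t => f (perturb a k v t)) d.

Lemma dir_derivE a k v f d :
  curve_derive (fun t => f (perturb a k v t)) d -> dir_deriv k v f a = d.
Proof. exact: curve_derive_val. Qed.

Lemma perturb0 a k v : perturb a k v 0 = a.
Proof. by apply/funext => j; rewrite /perturb mul0r addr0 if_same. Qed.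

Lemma smooth_at_cst a (c : CC R) : smooth_at a (fun=> c).
Proof. by move=> k v; exists 0; exact: curve_derive_cst. Qed.

Lemma smooth_atD a f g : smooth_at a f -> smooth_at a g ->
  smooth_at a (fun b => f b + g b).
Proof.
move=> sf sg k v; have [d fd] := sf k v; have [e ge] := sg k v.
by exists (d + e); exact: curve_deriveD.
Qed.

Lemma smooth_atM a f g : smooth_at a f -> smooth_at a g ->
  smooth_at a (fun b => f b * g b).
Proof.
move=> sf sg k v; have [d fd] := sf k v; have [e ge] := sg k v.
by eexists; exact: (curve_deriveM fd ge).
Qed.

Lemma curve_derive_coord a k v j :
  curve_derive (fun t => perturb a k v t j) (if j == k then v else 0).
Proof.
rewrite /perturb; case: eqP => _; first exact: curve_derive_line.
exact: curve_derive_cst.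
Qed.

Lemma smooth_at_coord a j : smooth_at a (fun b => b j).
Proof. by move=> k v; eexists; exact: curve_derive_coord. Qed.

Lemma smooth_at_conj a f : smooth_at a f -> smooth_at a (fun b => (f b)^*).
Proof.
by move=> sf k v; have [d fd] := sf k v; exists d^*; exact: curve_derive_conj.
Qed.

Lemma dir_derivD a f g k v : smooth_at a f -> smooth_at a g ->
  dir_deriv k v (fun b => f b + g b) a = dir_deriv k v f a + dir_deriv k v g a.
Proof.
move=> sf sg; have [d fd] := sf k v; have [e ge] := sg k v.
by rewrite (dir_derivE fd) (dir_derivE ge); apply/dir_derivE/curve_deriveD.
Qed.

Lemma dir_derivM a f g k v : smooth_at a f -> smooth_at a g ->
  dir_deriv k v (fun b => f b * g b) a =
  f a * dir_deriv k v g a + dir_deriv k v f a * g a.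
Proof.
move=> sf sg; have [d fd] := sf k v; have [e ge] := sg k v.
rewrite (dir_derivE fd) (dir_derivE ge).
by have := curve_deriveM fd ge; rewrite !perturb0; exact: dir_derivE.
Qed.

Lemma dir_deriv_cst a (c : CC R) k v : dir_deriv k v (fun=> c) a = 0.
Proof. by apply: dir_derivE; exact: curve_derive_cst. Qed.

Lemma poissonC K f g a : poisson K f g a = - poisson K g f a.
Proof.
rewrite /poisson -mulrN -sumrN; congr (_ * _); apply: eq_bigr => k _; ring_atoms.
Qed.

Lemma poissonDl K f g h a : smooth_at a f -> smooth_at a g ->
  poisson K (fun b => f b + g b) h a = poisson K f h a + poisson K g h a.
Proof.
move=> sf sg; rewrite /poisson -mulrDr -big_split; congr (_ * _).
apply: eq_bigr => k _; rewrite /d_alpha /d_alphabar !dir_derivD//=; ring_atoms.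
Qed.

Lemma poissonMl K f g h a : smooth_at a f -> smooth_at a g ->
  poisson K (fun b => f b * g b) h a =
  f a * poisson K g h a + g a * poisson K f h a.
Proof.
move=> sf sg; rewrite /poisson [f a * ('i * _)]mulrCA [g a * ('i * _)]mulrCA -mulrDr.
rewrite [f a * _]mulr_sumr [g a * _]mulr_sumr -big_split.
congr (_ * _).
apply: eq_bigr => k _; rewrite /d_alpha /d_alphabar !dir_derivM//=; ring_atoms.
Qed.

Lemma poisson_cstl K (c : CC R) g a : poisson K (fun=> c) g a = 0.
Proof.
rewrite /poisson big1 ?mulr0// => k _.
by rewrite /d_alpha /d_alphabar !dir_deriv_cst; ring.
Qed.

Lemma poisson_cstr K (c : CC R) g a : poisson K g (fun=> c) a = 0.
Proof. by rewrite poissonC poisson_cstl oppr0. Qed.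

Definition depends_on (P : pred 'I_m) f : Prop :=
  forall b c, (forall k, P k -> b k = c k) -> f b = f c.

Lemma dir_deriv_depends_on P f a k v :
  depends_on P f -> ~~ P k -> dir_deriv k v f a = 0.
Proof.
move=> Pf Pk; apply: dir_derivE.
rewrite (_ : (fun t => _) = fun=> f a); first exact: curve_derive_cst.
apply/funext => t; apply: Pf => i Pi; rewrite /perturb; case: eqP => // ik.
by rewrite -ik Pi in Pk.
Qed.

(** Each term of the bracket differentiates both functions in the same
    coordinate, and one of them does not depend on it. *)
Lemma poisson_disjoint P K f g a :
  depends_on P f -> depends_on (predC P) g -> poisson K f g a = 0.
Proof.
move=> Pf Pg; rewrite /poisson big1 ?mulr0// => k _.
rewrite /d_alpha /d_alphabar; have [Pk|Pk] := boolP (P k).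
  by rewrite !(dir_deriv_depends_on _ _ Pg) /= ?Pk//; ring.
by rewrite !(dir_deriv_depends_on _ _ Pf)//; ring.
Qed.

Lemma rho2 (c : CC R) : rho c ^+ 2 = 1 - c * c^*.
Proof. by rewrite sqrtCK normCK. Qed.

(** Only the term of index [j] survives: there [d_alpha] takes the values 1 and 0
    on the coordinate and its conjugate, and [d_alphabar] the values 0 and 1. *)
Lemma poisson_coord_conj K a j : (j < K)%N ->
  poisson K (fun b => b j) (fun b => (b j)^*) a = - 'i * (1 - a j * (a j)^*).
Proof.
move=> jK.
have dc k v : dir_deriv k v (fun b => b j) a = if j == k then v else 0.
  by apply: dir_derivE; exact: curve_derive_coord.
have dcc k v : dir_deriv k v (fun b => (b j)^*) a = (if j == k then v else 0)^*.
  by apply: dir_derivE; exact/curve_derive_conj/curve_derive_coord.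
rewrite /poisson (bigD1 j)//= big1 ?addr0 => [|k /andP[_ kj]].
  rewrite rho2 /d_alpha /d_alphabar !dc !dcc eqxx conjC1 conjCi.
  have ii : 'i * 'i = -1 :> CC R by rewrite -expr2 sqrCi.
  by rewrite !mulrN ii; field.
rewrite /d_alpha /d_alphabar !dc !dcc eq_sym (negbTE kj) conjC0; ring.
Qed.

Lemma poisson_self K a u : poisson K u u a = 0.
Proof. by rewrite /poisson big1 ?mulr0// => k _; ring. Qed.

(** Wall polynomials of index [n.+1] have the form [x f + y g u], where [f] and
    [g] have index [n] and [u] is the new coefficient or its conjugate. *)
Lemma poisson_step K a (x y x' y' : CC R) f g u f' g' u' :
    smooth_at a f -> smooth_at a g -> smooth_at a u ->
    smooth_at a f' -> smooth_at a g' -> smooth_at a u' ->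
    poisson K u f' a = 0 -> poisson K u g' a = 0 ->
    poisson K u' f a = 0 -> poisson K u' g a = 0 ->
  poisson K (fun b => x * f b + y * (g b * u b))
            (fun b => x' * f' b + y' * (g' b * u' b)) a =
  x * x' * poisson K f f' a + x * y' * u' a * poisson K f g' a +
  y * x' * u a * poisson K g f' a +
  y * y' * (u a * u' a * poisson K g g' a + g a * g' a * poisson K u u' a).
Proof.
have lin (c c' : CC R) p q r h : smooth_at a p -> smooth_at a q -> smooth_at a r ->
    poisson K (fun b => c * p b + c' * (q b * r b)) h a =
    c * poisson K p h a + c' * (q a * poisson K r h a + r a * poisson K q h a).
  move=> sp sq sr; have sc e := smooth_at_cst a e.
  have sqr := smooth_atM sq sr.
  rewrite poissonDl ?poissonMl//; try exact: smooth_atM.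
  by rewrite !poisson_cstl; ring_atoms.
move=> sf sg su sf' sg' su' uf ug uf' ug'.
have lin' h := lin x' y' f' g' u' h sf' sg' su'.
rewrite (lin x y f g u _ sf sg su) [poisson K f _ a]poissonC.
rewrite [poisson K g _ a]poissonC [poisson K u _ a]poissonC !lin' uf' ug'.
rewrite (poissonC K f' u) (poissonC K g' u) uf ug (poissonC K u' u).
rewrite (poissonC K f' f) (poissonC K f' g) (poissonC K g' f) (poissonC K g' g).
ring_atoms.
Qed.

(** * The bracket table and its induction step *)

(** The families are abstract functions of the spectral parameter, so that the
    induction step is pure algebra. *)
Record bracket_table K a (A B As Bs : CC R -> ('I_m -> CC R) -> CC R)
    (z w : CC R) : Prop := BracketTable {
  brAA : poisson K (A z) (A w) a = 0;
  brBB : poisson K (B z) (B w) a = 0;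
  brAsAs : poisson K (As z) (As w) a = 0;
  brBsBs : poisson K (Bs z) (Bs w) a = 0;
  brAAs : poisson K (A z) (As w) a =
    'i * A z a * As w a -
    'i / (z - w) * (z * Bs z a * B w a - w * Bs w a * B z a);
  brBBs : poisson K (B z) (Bs w) a =
    'i * z / (z - w) * (A z a * As w a - A w a * As z a);
  brAB : poisson K (A z) (B w) a =
    - 'i * w / (z - w) * (A z a * B w a - A w a * B z a);
  brABs : poisson K (A z) (Bs w) a =
    'i * z / (z - w) * (A z a * Bs w a - A w a * Bs z a);
  brBAs : poisson K (B z) (As w) a =
    'i * z / (z - w) * (B z a * As w a - B w a * As z a);
  brAsBs : poisson K (As z) (Bs w) a =
    - 'i * z / (z - w) * (As z a * Bs w a - As w a * Bs z a)
}.

(** The table at [(w, z)] is needed too: it supplies, by antisymmetry, the six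
    brackets at [(z, w)] with the arguments in the opposite order. *)
Lemma bracket_table_step K a A B As Bs u (v : (_ -> CC R) -> CC R) z w :
    (forall x, [/\ smooth_at a (A x), smooth_at a (B x),
                  smooth_at a (As x) & smooth_at a (Bs x)]) ->
    smooth_at a u -> smooth_at a v ->
    (forall x, [/\ poisson K u (A x) a = 0, poisson K u (B x) a = 0,
                  poisson K u (As x) a = 0 & poisson K u (Bs x) a = 0]) ->
    (forall x, [/\ poisson K v (A x) a = 0, poisson K v (B x) a = 0,
                  poisson K v (As x) a = 0 & poisson K v (Bs x) a = 0]) ->
    poisson K u v a = - 'i * (1 - u a * v a) -> z != w ->
    bracket_table K a A B As Bs z w -> bracket_table K a A B As Bs w z ->
  bracket_table K a
    (fun x b => 1 * A x b + x * (Bs x b * u b))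
    (fun x b => 1 * B x b + x * (As x b * u b))
    (fun x b => x * As x b + 1 * (B x b * v b))
    (fun x b => x * Bs x b + 1 * (A x b * v b)) z w.
Proof.
move=> smooth su sv uX vX uv zw.
move=> [AA BB AsAs BsBs AAs BBs AB ABs BAs AsBs].
move=> [_ _ _ _ AAs' BBs' AB' ABs' BAs' AsBs'].
have zw0 : z - w != 0 by rewrite subr_eq0.
have wz0 : w - z != 0 by rewrite subr_eq0 eq_sym.
have [sA sB sAs sBs] := smooth z; have [sA' sB' sAs' sBs'] := smooth w.
have [uA uB uAs uBs] := uX z; have [uA' uB' uAs' uBs'] := uX w.
have [vA vB vAs vBs] := vX z; have [vA' vB' vAs' vBs'] := vX w.
have vu : poisson K v u a = 'i * (1 - u a * v a).
  by rewrite poissonC uv mulNr opprK.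
have self := (poisson_self K a u, poisson_self K a v, uv, vu).
have BA : poisson K (B z) (A w) a = - poisson K (A w) (B z) a := poissonC _ _ _ _.
have AsA : poisson K (As z) (A w) a = - poisson K (A w) (As z) a := poissonC _ _ _ _.
have BsA : poisson K (Bs z) (A w) a = - poisson K (A w) (Bs z) a := poissonC _ _ _ _.
have AsB : poisson K (As z) (B w) a = - poisson K (B w) (As z) a := poissonC _ _ _ _.
have BsB : poisson K (Bs z) (B w) a = - poisson K (B w) (Bs z) a := poissonC _ _ _ _.
have BsAs : poisson K (Bs z) (As w) a = - poisson K (As w) (Bs z) a := poissonC _ _ _ _.
rewrite {}AAs' in AsA; rewrite {}BBs' in BsB; rewrite {}AB' in BA.
rewrite {}ABs' in BsA; rewrite {}BAs' in AsB; rewrite {}AsBs' in BsAs.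
split; rewrite poisson_step // ?self ?AA ?BB ?AsAs ?BsBs ?AAs ?BBs ?AB ?ABs
  ?BAs ?AsBs ?BA ?AsA ?BsA ?AsB ?BsB ?BsAs;
  by field; rewrite ?zw0 ?wz0.
Qed.

End PoissonRules.

(** * Recursion for the Wall polynomials *)

Section WallRecursion.
Variable R : realType.
Implicit Types (a : nat -> CC R) (z : CC R).

Lemma transfer_ext n a a' : (forall k, (k <= n)%N -> a k = a' k) ->
  transfer n a = transfer n a'.
Proof.
elim: n => [|n IH] aa' /=; first by rewrite aa'.
by rewrite aa'// IH// => k kn; apply: aa'; exact: leqW.
Qed.

Lemma wall0 a : [/\ wallA 0 a = (a 0%N)%:P, wallB 0 a = 1,
  wallAs 0 a = ((a 0%N)^*)%:P & wallBs 0 a = 1].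
Proof.
have [T00 T01 T10 T11] := transfer_wall 0 a; have X0 := polyX_eq0 (CC R).
split.
- apply: (mulfI (negbT X0)); apply: oppr_inj.
  by rewrite -T10 mxE /= mulrC mul_polyC.
- by rewrite -T11 mxE.
- by apply: oppr_inj; rewrite -T01 mxE.
- by apply: (mulfI (negbT X0)); rewrite -T00 mxE /= mulr1.
Qed.

(** Reads off the entries of [transfer_step (a n.+1) *m transfer n a]. *)
Lemma wallS n a :
  [/\ wallA n.+1 a = wallA n a + a n.+1 *: ('X * wallBs n a),
      wallB n.+1 a = wallB n a + a n.+1 *: ('X * wallAs n a),
      wallAs n.+1 a = 'X * wallAs n a + (a n.+1)^* *: wallB n a &
      wallBs n.+1 a = 'X * wallBs n a + (a n.+1)^* *: wallA n a].
Proof.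
have [S00 S01 S10 S11] := transfer_wall n a.
have [T00 T01 T10 T11] := transfer_wall n.+1 a.
have X0 := negbT (polyX_eq0 (CC R)).
have E0 : lift ord0 ord0 = 1 :> 'I_2 by apply/val_inj.
split.
- apply: (mulfI X0); apply: oppr_inj; rewrite -T10 /= mxE !big_ord_recl big_ord0.
  rewrite E0 !mxE/= S00 S10 -!mul_polyC; ring.
- rewrite -T11 /= mxE !big_ord_recl big_ord0 E0 !mxE/= S01 S11 -!mul_polyC; ring.
- apply: oppr_inj; rewrite -T01 /= mxE !big_ord_recl big_ord0 E0 !mxE/= S01 S11.
  rewrite -!mul_polyC; ring.
- apply: (mulfI X0); rewrite -T00 /= mxE !big_ord_recl big_ord0 E0 !mxE/= S00 S10.
  rewrite -!mul_polyC; ring.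
Qed.

End WallRecursion.

(** * Brackets of the Wall polynomials *)

Section WallBrackets.
Variables (R : realType) (m : nat).
Implicit Types (a b : 'I_m -> CC R) (z w : CC R).

Local Notation A n z := (fun b : 'I_m -> CC R => (wallA n (coords b)).[z]).
Local Notation B n z := (fun b : 'I_m -> CC R => (wallB n (coords b)).[z]).
Local Notation As n z := (fun b : 'I_m -> CC R => (wallAs n (coords b)).[z]).
Local Notation Bs n z := (fun b : 'I_m -> CC R => (wallBs n (coords b)).[z]).

Lemma coordsE b (j : 'I_m) : coords b j = b j.
Proof. by rewrite /coords insubT// => jm; congr (b _); apply/val_inj. Qed.

Lemma wall_fun0 (j : 'I_m) z : nat_of_ord j = 0%N ->
  [/\ A 0%N z = (fun b => b j), B 0%N z = (fun=> 1),
      As 0%N z = (fun b => (b j)^*) & Bs 0%N z = (fun=> 1)].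
Proof.
move=> j0; split; apply/funext => b; have [EA EB EAs EBs] := wall0 (coords b);
  by rewrite ?(EA, EB, EAs, EBs) !hornerE// -j0 coordsE.
Qed.

(** The factors [1] put the recursion in the shape expected by
    [poisson_step]. *)
Lemma wall_funS n (j : 'I_m) z : nat_of_ord j = n.+1 ->
  [/\ A n.+1 z = (fun b => 1 * A n z b + z * (Bs n z b * b j)),
      B n.+1 z = (fun b => 1 * B n z b + z * (As n z b * b j)),
      As n.+1 z = (fun b => z * As n z b + 1 * (B n z b * (b j)^*)) &
      Bs n.+1 z = (fun b => z * Bs n z b + 1 * (A n z b * (b j)^*))].
Proof.
move=> jn; split; apply/funext => b; have [EA EB EAs EBs] := wallS n (coords b);
  rewrite ?(EA, EB, EAs, EBs) !(hornerD, hornerZ, hornerM, hornerX) -jn coordsE;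
  by ring.
Qed.

Lemma wall_depends_on n z :
  let P : pred 'I_m := fun k => (k <= n)%N in
  [/\ depends_on P (A n z), depends_on P (B n z),
      depends_on P (As n z) & depends_on P (Bs n z)].
Proof.
have E (b c : 'I_m -> CC R) : (forall k : 'I_m, (k <= n)%N -> b k = c k) ->
    transfer n (coords b) = transfer n (coords c).
  move=> bc; apply: transfer_ext => k kn; rewrite /coords.
  by case: insubP => //= i _ ik; apply: bc; rewrite ik.
by split=> b c /E bc; rewrite /wallAs /wallBs /wallA /wallB bc.
Qed.

Lemma wall_smooth n a z : (n < m)%N ->
  [/\ smooth_at a (A n z), smooth_at a (B n z),
      smooth_at a (As n z) & smooth_at a (Bs n z)].
Proof.
have sc c := smooth_at_cst a c; have sx j := smooth_at_coord a j.
have sxc j := smooth_at_conj (sx j).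
elim: n => [|n IH] nm.
  have [-> -> -> ->] := wall_fun0 (j := Ordinal nm) z erefl.
  by split.
have [-> -> -> ->] := wall_funS (j := Ordinal nm) z erefl.
have [sA sB sAs sBs] := IH (ltnW nm).
by split; apply: smooth_atD; do ?[exact: smooth_atM|apply: smooth_atM => //].
Qed.

Lemma wall_bracket_table K n a z w : (n < K)%N -> (K <= m)%N -> z != w ->
  bracket_table K a (fun x => A n x) (fun x => B n x)
    (fun x => As n x) (fun x => Bs n x) z w.
Proof.
move=> nK Km; elim: n nK z w => [|n IH] nK z w zw.
  pose j := Ordinal (leq_trans nK Km).
  have zw0 : z - w != 0 by rewrite subr_eq0.
  have uv := poisson_coord_conj a (nK : (j < K)%N).
  pose V x := wall_fun0 x (erefl : nat_of_ord j = 0%N).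
  have -> : (fun x => A 0%N x) = (fun x b => b j).
    by apply/funext => x; have [-> _ _ _] := V x.
  have -> : (fun x => B 0%N x) = (fun x b => 1).
    by apply/funext => x; have [_ -> _ _] := V x.
  have -> : (fun x => As 0%N x) = (fun x b => (b j)^*).
    by apply/funext => x; have [_ _ -> _] := V x.
  have -> : (fun x => Bs 0%N x) = (fun x b => 1).
    by apply/funext => x; have [_ _ _ ->] := V x.
  by split; rewrite ?(poisson_cstl, poisson_cstr, poisson_self, uv)//; field.
have jm : (n.+1 < m)%N := leq_trans nK Km; pose j := Ordinal jm.
pose V x := wall_funS x (erefl : nat_of_ord j = n.+1).
have -> : (fun x => A n.+1 x) = (fun x b => 1 * A n x b + x * (Bs n x b * b j)).
  by apply/funext => x; have [-> _ _ _] := V x.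
have -> : (fun x => B n.+1 x) = (fun x b => 1 * B n x b + x * (As n x b * b j)).
  by apply/funext => x; have [_ -> _ _] := V x.
have -> : (fun x => As n.+1 x) = (fun x b => x * As n x b + 1 * (B n x b * (b j)^*)).
  by apply/funext => x; have [_ _ -> _] := V x.
have -> : (fun x => Bs n.+1 x) = (fun x b => x * Bs n x b + 1 * (A n x b * (b j)^*)).
  by apply/funext => x; have [_ _ _ ->] := V x.
pose P : pred 'I_m := fun k => (n < k)%N.
have Pu : depends_on P (fun b : 'I_m -> CC R => b j).
  by move=> b c; apply; rewrite /P /= ltnSn.
have Puc : depends_on P (fun b : 'I_m -> CC R => (b j)^*).
  by move=> b c /Pu ->.
have indep u f : depends_on P u -> depends_on (fun k => k <= n)%N f ->
    poisson K u f a = 0.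
  move=> Pg Pf; apply: (poisson_disjoint _ _ Pg) => b c bc; apply: Pf => k kn.
  by apply: bc; rewrite /= /P -leqNgt.
apply: (@bracket_table_step R m K a _ _ _ _ (fun b => b j) (fun b => (b j)^*)) => //.
- by move=> x; exact: wall_smooth (ltnW jm).
- exact: smooth_at_coord.
- exact/smooth_at_conj/smooth_at_coord.
- by move=> x; have [] := wall_depends_on n x; split; exact: indep.
- by move=> x; have [] := wall_depends_on n x; split; exact: indep.
- exact: poisson_coord_conj.
- exact: IH (ltnW nK) _ _ zw.
- by apply: IH (ltnW nK) _ _ _; rewrite eq_sym.
Qed.

Lemma wall_brackets_hold K n a : (n < K)%N -> (K <= m)%N -> wall_brackets K n a.
Proof.
by rewrite /wall_brackets /= => nK Km z w zw; case: (wall_bracket_table a nK Km zw).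
Qed.

End WallBrackets.

Theorem proposition2p7 (R : realType) (n : nat)
    (mu : probability (borelCC R) R)
    (hmu : mu (unit_circle R : set (borelCC R)) = 1%E) :
  (forall (N : nat),
     measure_support mu #= `I_N -> (n.+2 <= N)%N ->
     (forall b : 'I_N -> CC R, finite_phase b -> wall_brackets N.-1 n b) /\
     (forall a : 'I_N -> CC R, verblunsky mu N (coords a) ->
        wall_brackets N.-1 n a))
  /\
  (forall (p : nat) (a : nat -> CC R),
     infinite_set (measure_support mu) -> (forall m, verblunsky mu m a) ->
     (forall k, a (k + p)%N = a k) -> ~~ odd p -> (n.+1 <= p)%N ->
     (forall b : 'I_p -> CC R, periodic_phase b -> wall_brackets p n b) /\
     wall_brackets p n (fun k : 'I_p => a k)).
Proof.
split=> [N _ nN|p a _ _ _ _ np].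
  have nK : (n < N.-1)%N by rewrite -ltnS prednK// (leq_trans _ nN).
  by split=> b _; apply: wall_brackets_hold => //; exact: leq_pred.
by split=> [b _|]; exact: wall_brackets_hold.
Qed.
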